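(* Let $W$ be a finite nonempty multiset of positive real numbers and let $\mathcal{T}_W$ be the set of all weighted trees $T$ whose multiset of edge weights $\{\omega(e): e\in E(T)\}$ equals $W$. Then the elements of $\mathcal{T}_W$ maximizing the average hitting time $\alpha$ are exactly the polarized paths in $\mathcal{T}_W$, and the weighted star $S_W$ is the unique element of $\mathcal{T}_W$ (up to weighted isomorphism) minimizing $\alpha$.
   Context: A weighted graph $G=(V,E)$ has positive edge weights $\omega(e)$; the random walk on $G$ moves from $u$ to a neighbor $v$ with probability proportional to $\omega(uv)$. The hitting time $H_G(u,v)$ is the expected number of steps for the walk started at $u$ to first reach $v$ ($H_G(v,v)=0$), and the average hitting time is $\alpha(G)=\frac{1}{|V|^2}\sum_{u,v\in V}H_G(u,v)$. $S_W$ denotes the unique element of $\mathcal{T}_W$ whose underlying graph is a star. For a weighted path $P=v_1v_2\dots v_n$ with edges $e_i=v_iv_{i+1}$, $i\in\{1,\dots,n-1\}$, set $c(e_i)=\min\{i,n-i\}$; $P$ is called polarized if $\omega(e_i)\ge\omega(e_j)$ whenever $c(e_i)\le c(e_j)$ (more centrally located edges carry smaller weights).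
   Formalization: ''Polarized'' is taken with ω(e_i) ≥ ω(e_j) whenever c(e_i) < c(e_j) (strict): with ≤, edges at equal distance from the centre would need equal weights, so for W={1,2} no path is polarized although a maximizer of α exists. *)

(* Defs.v *)
From HB Require Import structures.
From mathcomp Require Import all_boot all_order all_algebra.
From mathcomp Require Import finmap multiset.
From mathcomp Require Import reals constructive_ereal ereal topology sequences.

Set Implicit Arguments.
Unset Strict Implicit.
Unset Printing Implicit Defensive.

Import Order.TTheory GRing.Theory Num.Theory.

Local Open Scope ring_scope.

(* The values of [wt] outside [edges] are irrelevant: every definition below  *)
(* only looks at the weights of edges.                                        *)
Record wgraph (R : realType) := WGraph {
  vert : finType;
  edges : {set {set vert}};
  wt : {set vert} -> R;
  edges_card2 : forall e, e \in edges -> #|e| = 2%N;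
  wt_gt0 : forall e, e \in edges -> 0 < wt e
}.

Section WeightedGraph.
Variables (R : realType) (G : wgraph R).
Implicit Types (u v : vert G).

Definition adj : rel (vert G) := fun u v => [set u; v] \in edges G.

Definition trans u v : R :=
  if adj u v then wt [set u; v] / \sum_(w | adj u w) wt [set u; w] else 0.

Definition traj_prob u (s : seq (vert G)) : R :=
  \prod_(a <- zip (u :: s) s) trans a.1 a.2.

(* P_u(tau_v = t), where tau_v is the first time at which the walk is at v:   *)
(* as u :: s has t + 1 entries, index v (u :: s) = t says that v occurs at    *)
(* its last position and nowhere before.                                      *)
Definition hit_prob u v (t : nat) : R :=
  \sum_(s : t.-tuple (vert G) | index v (u :: s) == t) traj_prob u s.

(* Expectation of tau_v as a random variable with values in nat plus          *)
(* infinity. The second summand is the contribution of the event that v is    *)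
(* never reached (0 when that event has probability 0, as +oo * 0 = 0).       *)
Definition hitting_time u v : \bar R :=
  (\sum_(t <oo) (t%:R * hit_prob u v t)%:E
   + +oo * (1 - \sum_(t <oo) (hit_prob u v t)%:E))%E.

Definition avg_hitting_time : \bar R :=
  (((#|vert G| ^ 2)%:R^-1)%:E
   * \sum_(u : vert G) \sum_(v : vert G) hitting_time u v)%E.

Definition is_connected := (0 < #|vert G|)%N /\ forall u v, connect adj u v.

Definition is_acyclic :=
  forall c : seq (vert G), ucycle adj c -> (size c <= 2)%N.

Definition is_tree := is_connected /\ is_acyclic.

Definition is_star :=
  exists c : vert G, edges G = [set [set c; v] | v in [set~ c]].

(* The vertices are p 1, ..., p n; the other values of p play no role.        *)
Definition path_labelling (n : nat) (p : nat -> vert G) :=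
  [/\ {in [pred i | (1 <= i <= n)%N] &, injective p},
      forall x, exists2 i, (1 <= i <= n)%N & x = p i &
      forall e, e \in edges G <->
        exists2 i, (1 <= i < n)%N & e = [set p i; p i.+1]].

Definition path_c (n i : nat) : nat := minn i (n - i).

(* The inequality between the c's is strict: the edges e_i and e_(n-i) are at *)
(* equal distance from the centre and may carry different weights.            *)
Definition polarized (n : nat) (p : nat -> vert G) :=
  forall i j, (1 <= i < n)%N -> (1 <= j < n)%N -> (path_c n i < path_c n j)%N ->
    wt [set p j; p j.+1] <= wt [set p i; p i.+1].

Definition is_polarized_path :=
  exists n p, path_labelling n p /\ polarized n p.

End WeightedGraph.

Definition wisom (R : realType) (G H : wgraph R) :=
  exists f : vert G -> vert H,
    [/\ bijective f,
        forall e : {set vert G}, (f @: e \in edges H) = (e \in edges G) &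
        forall e : {set vert G}, e \in edges G -> wt (f @: e) = wt e].

Section TreesWithWeights.
Variables (R : realType) (W : {mset R}%mset).

Definition TW (T : wgraph R) :=
  is_tree T /\ seq_mset [seq wt e | e in edges T] = W.

Definition maximizes_alpha (T : wgraph R) :=
  TW T /\
  forall T', TW T' -> (avg_hitting_time T' <= avg_hitting_time T)%E.

Definition minimizes_alpha (T : wgraph R) :=
  TW T /\
  forall T', TW T' -> (avg_hitting_time T <= avg_hitting_time T')%E.

End TreesWithWeights.

(* Main.v *)
(* In a tree with weighted degrees summing to [vol], the expected time to go    *)
(* from [u] to [v] is the sum, over the edges [e] separating [u] from [v], of   *)
(* the volume of the component of [u] in [T - e] divided by the weight of [e].  *)
(* Summing over all pairs, the average hitting time becomes                     *)
(*   vol / n^2 * sum over e of a_e * (n - a_e) / wt e,                          *)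
(* where [a_e <= n / 2] is the size of the smaller component of [T - e], and    *)
(* [n] and [vol] only depend on the multiset of weights.                        *)
(*   For the maximum, write a * (n - a) as the sum of n - 1 - 2k over k < a.    *)
(* Two disjoint components of size > k which are minimal for inclusion contain  *)
(* at least 2k edges with [a_e <= k]; hence at most n - 1 - 2k edges have       *)
(* [a_e > k], and the sum of the inverses of their weights is at most that of   *)
(* the n - 1 - 2k largest inverse weights. A polarized path reaches this bound  *)
(* for every k. Equality for k = 1 leaves at most two leaves, so that the tree  *)
(* is a path, and equality for all k says that it is polarized.                 *)
(*   For the minimum, a * (n - a) >= n - 1, with equality only for a = 1, and   *)
(* the trees all of whose edges are pendant are the stars.                      *)

Require Import Defs.
From HB Require Import structures.
From mathcomp Require Import all_boot all_order all_algebra.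
From mathcomp Require Import finmap multiset.
From mathcomp Require Import reals constructive_ereal ereal topology sequences.
From mathcomp Require Import normedtype.
From mathcomp Require Import zify ring lra.

Set Implicit Arguments.
Unset Strict Implicit.
Unset Printing Implicit Defensive.

Import Order.TTheory GRing.Theory Num.Theory.

Local Open Scope ring_scope.

(** * Expectation of the hitting time *)

(** The first-step equations on a finite graph determine the hitting time: by
    [hitting_time_poisson], any nonnegative solution vanishing at the target is the expectation. In
    a tree the explicit sum [tree_hit] solves them, because the branches at a vertex partition the
    other vertices ([sum_branches]). Summing over pairs ([sum_tree_hit]) shows that, for fixed
    weights, the average is a positive constant times [cut_sum], the sum of a(n - a)/wt over the
    edges, where a is [cut_size]; [avg_hitting_time_le] turns comparisons of averages into
    comparisons of [cut_sum].

    For the maximum, [cut_sum_deep] slices [cut_sum] into sums of inverse weights over the edges of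
    cut size > k, with coefficients n - 1 - 2k. [card_deep] bounds the number of such edges and
    [polarized_deep] shows that a polarized path attains the bound with its largest inverse weights,
    so [top_part_sum] compares the slices one by one. In case of equality, the slice k = 1 and
    [degree_le] bound all degrees by 2, whence a path ([path_of_degree]), and the other slices order
    its weights.

    For the minimum, a(n - a) >= n - 1 edge by edge ([cut_sum_ge]), with equality everywhere only
    for stars ([star_of_cut_size]); two stars with the same weights are isomorphic by matching
    leaves ([star_wisom]). Both extremal trees are built by [parent_graph]. *)

Section HittingTimes.
Import numFieldNormedType.Exports.
Local Open Scope classical_set_scope.
Variables (R : realType) (G : wgraph R).
Implicit Types (u v w : vert G) (t N : nat).

Lemma trans_ge0 u w : 0 <= trans u w.
Proof.
rewrite /trans; case: ifP => // uw; apply: divr_ge0; first exact/ltW/wt_gt0.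
by apply: sumr_ge0 => x ux; exact/ltW/wt_gt0.
Qed.

Lemma hit_prob0 u v : hit_prob u v 0 = (u == v)%:R.
Proof.
rewrite /hit_prob big_mkcond (bigD1 [tuple]) //= big1 ?addr0; last first.
  by move=> s /eqP[]; rewrite [LHS]tuple0 [RHS]tuple0.
rewrite /traj_prob /= big_nil; case: (u == v) => //=.
Qed.

Lemma hit_probS u v t :
  hit_prob u v t.+1 = if u == v then 0 else \sum_w trans u w * hit_prob w v t.
Proof.
rewrite /hit_prob.
have bij : {on [pred s : t.+1.-tuple (vert G) | index v (u :: s) == t.+1], bijective
  (fun p : vert G * t.-tuple (vert G) => cons_tuple p.1 p.2)}.
  exists (fun s => (thead s, behead_tuple s)) => [[w s] _|s _] /=.
    by congr (_, _); apply: val_inj.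
  by rewrite [in RHS](tuple_eta s); apply: val_inj.
rewrite (reindex _ bij) /=; case: ifP => uv; first by rewrite big_pred0.
transitivity (\sum_(p : vert G * t.-tuple (vert G) | index v (p.1 :: p.2) == t)
    trans u p.1 * traj_prob p.1 p.2).
  by apply: eq_big => [p|p _] //; rewrite /traj_prob /= big_cons.
rewrite -(pair_big_dep xpredT (fun w (s : t.-tuple (vert G)) => index v (w :: s) == t)
  (fun w s => trans u w * traj_prob w s)) /=.
by apply: eq_bigr => w _; rewrite big_distrr.
Qed.

Section Target.
Variable v : vert G.

Lemma sum_hit_probS (c : nat -> R) u N :
  \sum_(0 <= t < N.+1) c t * hit_prob u v t =
  if u == v then c 0%N
  else \sum_w trans u w * \sum_(0 <= t < N) c t.+1 * hit_prob w v t.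
Proof.
rewrite big_nat_recl // hit_prob0; case: ifP => uv.
  rewrite mulr1 big1 ?addr0 // => t _; by rewrite hit_probS uv mulr0.
rewrite mulr0 add0r.
under eq_bigr => t _ do rewrite hit_probS uv mulr_sumr.
rewrite exchange_big; apply: eq_bigr => w _; rewrite mulr_sumr.
by apply: eq_bigr => t _; rewrite mulrCA.
Qed.

(** [F N u] is the probability that [tau_v < N], and [E N u] the expectation of [tau_v] restricted
    to that event. *)
Let F N u := \sum_(0 <= t < N) hit_prob u v t.
Let E N u := \sum_(0 <= t < N) t%:R * hit_prob u v t.

Lemma hit_prob_ge0 u t : 0 <= hit_prob u v t.
Proof.
elim: t u => [|t IH] u; first by rewrite hit_prob0.
rewrite hit_probS; case: ifP => // _; apply: sumr_ge0 => w _.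
exact/mulr_ge0/IH/trans_ge0.
Qed.

Let FS N u : F N.+1 u = if u == v then 1 else \sum_w trans u w * F N w.
Proof.
have FE M x : F M x = \sum_(0 <= t < M) 1 * hit_prob x v t.
  by apply: eq_bigr => t _; rewrite mul1r.
rewrite FE sum_hit_probS; case: ifP => // _.
by apply: eq_bigr => w _; rewrite FE.
Qed.

Let ES N u : E N.+1 u = if u == v then 0 else \sum_w trans u w * (E N w + F N w).
Proof.
rewrite /E sum_hit_probS; case: ifP => // _.
apply: eq_bigr => w _; congr (_ * _); rewrite /F -big_split /=.
by apply: eq_bigr => t _; rewrite -natr1 mulrDl mul1r.
Qed.

Variable h : vert G -> R.
Hypothesis h_ge0 : forall u, 0 <= h u.
Hypothesis h_tgt : h v = 0.
Hypothesis h_off : forall u, u != v -> h u = 1 + \sum_w trans u w * h w.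
Hypothesis trans1 : forall u, u != v -> \sum_w trans u w = 1.

Let F_le1 N u : F N u <= 1.
Proof.
elim: N u => [|N IH] u; first by rewrite /F big_geq.
rewrite FS; case: eqVneq => // uv.
rewrite -(trans1 uv); apply: ler_sum => w _.
by rewrite ler_piMr ?trans_ge0.
Qed.

Let avg_compl u c (f : vert G -> R) : u != v ->
  c * (1 - \sum_w trans u w * f w) = \sum_w trans u w * (c * (1 - f w)).
Proof.
move=> uv; rewrite -[X in X - _](trans1 uv) -sumrB mulr_sumr.
by apply: eq_bigr => w _; ring.
Qed.

Let avg_add1 u (f : vert G -> R) : u != v ->
  1 + \sum_w trans u w * f w = \sum_w trans u w * (1 + f w).
Proof.
move=> uv; rewrite -[X in X + _](trans1 uv) -big_split.
by apply: eq_bigr => w _ /=; ring.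
Qed.

(* The left-hand side is the expectation of [min tau_v N]. *)
Let stop_le N u : E N u + N%:R * (1 - F N u) <= h u.
Proof.
elim: N u => [|N IH] u; first by rewrite /E /F !big_geq ?mul0r ?addr0.
rewrite ES FS; case: eqVneq => [->|uv]; first by rewrite h_tgt subrr mulr0 addr0.
rewrite h_off // avg_compl // avg_add1 // -big_split /=.
apply: ler_sum => w _; rewrite -mulrDr; apply: ler_wpM2l; first exact: trans_ge0.
by have := IH w; rewrite -natr1; lra.
Qed.

(** A walk that has not hit [v] before time N has spent N steps, and the value of [h] where it
    stands, at most M, accounts for the rest. *)
Let stop_ge M N u : (forall w, h w <= M) ->
  h u <= E N u + (N%:R + M) * (1 - F N u).
Proof.
move=> hM; elim: N u => [|N IH] u.
  by rewrite /E /F !big_geq // !add0r subr0 mulr1.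
rewrite ES FS; case: eqVneq => [->|uv]; first by rewrite h_tgt subrr mulr0 addr0.
rewrite h_off // avg_compl // avg_add1 // -big_split /=.
apply: ler_sum => w _; rewrite -mulrDr; apply: ler_wpM2l; first exact: trans_ge0.
by have := IH w; rewrite -natr1; lra.
Qed.

Let tail_le N K u : (N <= K)%N -> E N u + N%:R * (F K u - F N u) <= E K u.
Proof.
move=> NK; rewrite /E /F (big_cat_nat _ NK) //= [X in _ <= X](big_cat_nat _ NK) //=.
rewrite addrAC subrr add0r lerD2l mulr_sumr.
apply: ler_sum_nat => t /andP[Nt _].
by apply: ler_wpM2r; rewrite ?hit_prob_ge0 ?ler_nat.
Qed.

(** Markov's inequality: [stop_le] bounds the probability of [tau_v >= N] by [h u / N]. *)
Let F_cvg u : (fun N => F N u) @ \oo --> (1 : R).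
Proof.
apply: (@squeeze_cvgr _ _ _ _ (fun N => 1 - h u * N%:R^-1) (fun=> 1)).
- exists 1%N => // N /= N0; rewrite F_le1 andbT lerBlDr -lerBlDl.
  have NR : 0 < N%:R :> R by rewrite ltr0n.
  rewrite ler_pdivlMr // mulrC; apply: le_trans (stop_le N u).
  rewrite lerDr; apply: sumr_ge0 => t _.
  by rewrite mulr_ge0 ?hit_prob_ge0.
- rewrite -[X in _ --> X]subr0; apply: cvgB; first exact: cvg_cst.
  rewrite -[X in _ --> X](mulr0 (h u)); apply: cvgM; first exact: cvg_cst.
  rewrite -cvg_shiftS; exact: cvg_harmonic.
- exact: cvg_cst.
Qed.

(** The limit l of [E N u] is at most [h u] by [stop_le]. For the converse, the missing mass N(1 -
    F) of [stop_ge] is absorbed by the tail of the convergent series: letting K grow in [tail_le]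
    gives [E N u] + N(1 - [F N u]) <= l, so only M(1 - F) remains, which tends to 0. *)
Let E_cvg u : (fun N => E N u) @ \oo --> h u.
Proof.
have E_nd : nondecreasing_seq (fun N => E N u).
  move=> N K NK; rewrite /E [leRHS](big_cat_nat _ NK) //= lerDl.
  by apply: sumr_ge0 => t _; rewrite mulr_ge0 ?hit_prob_ge0.
have E_le N : E N u <= h u.
  apply: le_trans (stop_le N u); rewrite lerDl mulr_ge0 // subr_ge0; exact: F_le1.
have E_cv : cvgn (fun N => E N u).
  by apply: nondecreasing_is_cvgn => //; exists (h u) => _ [N _ <-].
suff -> : h u = limn (fun N => E N u) by [].
set l := limn _; apply/eqP; rewrite eq_le; apply/andP; split; last first.
  by apply: limr_le => //; exact: nearW.
have l_ge N : E N u + N%:R * (1 - F N u) <= l.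
  have Fl : (fun K => E N u + N%:R * (F K u - F N u)) @ \oo -->
      E N u + N%:R * (1 - F N u).
    apply: cvgD; first exact: cvg_cst.
    apply: cvgM; first exact: cvg_cst.
    by apply: cvgB; [exact: F_cvg | exact: cvg_cst].
  by apply: (ler_cvg_to Fl E_cv); exists N => // K /= NK; exact: tail_le.
pose M := \sum_w h w.
have hM w : h w <= M.
  by rewrite /M (bigD1 w) //= lerDl sumr_ge0.
have hl N : h u <= l + M * (1 - F N u).
  by have := l_ge N; have := stop_ge N u hM; lra.
suff Ml : (fun N => l + M * (1 - F N u)) @ \oo --> l.
  by apply: (cvgr_to_ge Ml); exact: nearW.
rewrite -[X in _ --> X]addr0 -(mulr0 M) -(subrr (1 : R)).
apply: cvgD; first exact: cvg_cst.
apply: cvgM; first exact: cvg_cst.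
by apply: cvgB; [exact: cvg_cst | exact: F_cvg].
Qed.

(** Since the hitting probabilities sum to 1, the infinite term in the definition is +oo * 0 = 0 and
    only the limit of [E] is left. *)
Lemma hitting_time_poisson u : hitting_time u v = (h u)%:E.
Proof.
have series_fin (x : nat -> R) (l : R) :
    (fun N => \sum_(0 <= t < N) x t) @ \oo --> l ->
    (\sum_(t <oo) (x t)%:E)%E = l%:E.
  move=> xl; apply/cvg_lim => //; apply: cvg_EFin.
    by apply: nearW => N; rewrite sumEFin.
  by apply: cvg_trans xl; apply: near_eq_cvg; apply: nearW => N /=; rewrite sumEFin.
rewrite /hitting_time (series_fin _ _ (@E_cvg u)) (series_fin _ _ (@F_cvg u)).
by rewrite subee // mule0 adde0.
Qed.

End Target.

End HittingTimes.

(** * Average hitting time of a tree *)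

Section Sides.
Variables (R : realType) (G : wgraph R).
Implicit Types (u v w x y z : vert G) (e f : {set vert G}).

Definition adj_off e : rel (vert G) := fun x y => adj x y && ([set x; y] != e).

Definition side e x : {set vert G} := [set y | connect (adj_off e) x y].

Lemma adj_sym : symmetric (@adj R G).
Proof. by move=> x y; rewrite /adj setUC. Qed.

Lemma adj_neq x y : adj x y -> x != y.
Proof. by move=> /edges_card2; rewrite cards2; case: eqP. Qed.

Lemma edge_ends e : e \in edges G -> exists x y, adj x y /\ e = [set x; y].
Proof.
move=> eG; have /eqP/cards2P[x [y [_ exy]]] := edges_card2 eG.
by exists x, y; rewrite /adj -exy.
Qed.

Lemma adj_off_sym e : symmetric (adj_off e).
Proof. by move=> x y; rewrite /adj_off adj_sym setUC. Qed.

Lemma side_refl e x : x \in side e x.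
Proof. by rewrite inE connect0. Qed.

Lemma side_eq e x y : y \in side e x -> side e y = side e x.
Proof.
rewrite inE => xy; apply/setP => z; rewrite !inE.
by rewrite (same_connect (sym_connect_sym (adj_off_sym e)) xy).
Qed.

Lemma side_step e x y : adj x y -> [set x; y] != e -> side e y = side e x.
Proof. by move=> xy ne; apply: side_eq; rewrite inE connect1 // /adj_off xy. Qed.

(** A walk inside [side e a] never uses [f], which has an end outside. *)
Lemma side_sub e f a z : z \in f -> z \notin side e a -> side e a \subset side f a.
Proof.
move=> zf za; apply/subsetP => y; rewrite !inE => /connectP[p].
elim/last_ind: p y => [|p x IH] y; first by move=> _ ->; rewrite connect0.
rewrite rcons_path last_rcons => /andP[ap px] ->.
have ax : connect (adj_off e) a (last a p) by apply/connectP; exists p.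
apply: connect_trans (IH _ ap erefl) (connect1 _).
have [lx _] := andP px; rewrite /adj_off lx /=.
apply: contra za => /eqP lxf; move: zf; rewrite -lxf !inE => /orP[/eqP->//|/eqP->].
exact: connect_trans ax (connect1 px).
Qed.

Hypothesis G_tree : is_tree G.

(** A simple path from [u] to [w] avoiding their edge would close up with it into a cycle of length
    at least 3. *)
Lemma side_far u w : adj u w -> w \notin side [set u; w] u.
Proof.
move=> uw; apply/negP; rewrite inE => /connectP[p0 /shortenP[p up Up _ wp]].
have upG : path (@adj R G) u p by apply: sub_path up => x y /andP[].
have /G_tree.2 : ucycle (@adj R G) (u :: p).
  by rewrite /ucycle Up andbT /= rcons_path upG -wp adj_sym.
case: p wp up {upG Up} => [wu|x [|//]] /=.
  by move: uw; rewrite wu => /adj_neq; rewrite eqxx.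
by move=> <-; rewrite /adj_off eqxx andbF.
Qed.

Lemma sideC u w : adj u w -> side [set u; w] w = ~: side [set u; w] u.
Proof.
move=> uw; apply/setP => y; rewrite in_setC; apply/idP/idP => [yw|].
  apply/negP => yu; have := side_far uw.
  by rewrite -(side_eq yu) (side_eq yw) side_refl.
have /connectP[p] := G_tree.1.2 u y.
elim/last_ind: p y => [|p x IH] y; first by move=> _ ->; rewrite side_refl.
rewrite rcons_path last_rcons => /andP[up px] ->.
have [lx|lx] := eqVneq [set last u p; x] [set u; w].
  have : x \in [set u; w] by rewrite -lx !inE eqxx orbT.
  by rewrite !inE => /orP[] /eqP ->; rewrite connect0.
have key z : (x \in side [set u; w] z) = (last u p \in side [set u; w] z).
  by apply/idP/idP => h; rewrite -(side_eq h) ?(side_step px) ?side_refl // -(side_step px) ?side_refl.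
by rewrite !key; apply: IH.
Qed.

Lemma branch_exists u x : x != u -> exists2 w, adj u w & x \in side [set u; w] w.
Proof.
move=> xu; have /connectP[p0 /shortenP[p up Up _ xp]] := G_tree.1.2 u x.
case: p up Up xp => [_ _ /eqP|w p]; first by rewrite (negPf xu).
rewrite [path _ _ _]/= => /andP[uw wp] /= /and3P[up _ _] xp; exists w => //.
(* The rest of a simple path from [u] never returns to [u], hence never uses the edge to [w]. *)
rewrite inE; apply/connectP; exists p => //.
apply: (@sub_in_path _ (predC1 u) (@adj R G)) wp => [a b au bu ab|].
  rewrite /adj_off ab; apply: contra au => /eqP E /=.
  have : u \in [set a; b] by rewrite E !inE eqxx.
  by rewrite !inE ![u == _]eq_sym (negPf bu) orbF.
by apply/allP => y yp; apply: contraNneq up => <-.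
Qed.

Lemma branch_unique u w w' x : adj u w -> adj u w' ->
  x \in side [set u; w] w -> x \in side [set u; w'] w' -> w = w'.
Proof.
move=> uw uw' xw xw'; apply/eqP/negPn/negP => ww'.
(* The branch of [w'] misses [u], so it survives the removal of the edge [u w]; it then lies on the
   side of [u], away from the branch of [w]. *)
have uN : u \notin side [set u; w'] w' by rewrite (sideC uw') inE side_refl.
have /subsetP/(_ x xw') := @side_sub _ [set u; w] _ _ (set21 u w) uN.
rewrite (@side_step _ u) //; last first.
  apply: contra ww' => /eqP E.
  have : w \in [set u; w'] by rewrite E !inE eqxx orbT.
  by rewrite !inE [w == u]eq_sym (negPf (adj_neq uw)).
by move=> h; move: xw; rewrite (sideC uw) inE h.
Qed.

Lemma sum_branches (V : nmodType) (f : vert G -> V) u :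
  \sum_x f x = f u + \sum_(w | adj u w) \sum_(x in side [set u; w] w) f x.
Proof.
rewrite (bigD1 u) //=; congr (_ + _).
rewrite (exchange_big_dep xpredT) //= big_mkcond; apply: eq_bigr => x _.
case: eqVneq => [->|xu] /=.
  by rewrite big1 // => w /andP[uw]; rewrite (sideC uw) inE side_refl.
have [w uw xw] := branch_exists xu.
rewrite (big_pred1 w) // => w' /=; apply/andP/eqP => [[uw' xw']|->//].
exact: branch_unique uw' uw xw' xw.
Qed.

Lemma sum_sides (V : nmodType) (f : vert G -> V) u w : adj u w ->
  \sum_x f x = \sum_(x in side [set u; w] u) f x + \sum_(x in side [set u; w] w) f x.
Proof.
move=> uw; rewrite (bigID (mem (side [set u; w] u))) /=; congr (_ + _).
by apply: eq_bigl => x; rewrite (sideC uw) !inE.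
Qed.

(** * Hitting times as sums over separating edges *)

Definition wdeg x : R := \sum_(w | adj x w) wt [set x; w].
Definition vol (A : {set vert G}) : R := \sum_(x in A) wdeg x.

(* A walk from [u] to [v] crosses exactly the edges that separate them, and     *)
(* the expected time to cross [e] from the side of [u] is [vol (side e u) /     *)
(* wt e].                                                                       *)
Definition tree_hit v u : R :=
  \sum_(e in edges G) (v \notin side e u)%:R * vol (side e u) / wt e.

Lemma vol_ge0 A : 0 <= vol A.
Proof.
by apply: sumr_ge0 => x _; apply: sumr_ge0 => w xw; exact/ltW/wt_gt0.
Qed.

Lemma vol_sideC u w : adj u w ->
  vol (side [set u; w] u) = vol setT - vol (side [set u; w] w).
Proof.
move=> uw; rewrite /vol; apply/eqP; rewrite eq_sym subr_eq -sum_sides //.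
by apply/eqP/eq_bigl => x; rewrite inE.
Qed.

(** The ends [u] and [w] lie on the same side of every other edge, so only the term of their own
    edge changes. *)
Lemma tree_hit_sub v u w : adj u w -> wt [set u; w] * (tree_hit v u - tree_hit v w) =
  (v \in side [set u; w] w)%:R * vol setT - vol (side [set u; w] w).
Proof.
move=> uw; rewrite /tree_hit -sumrB (bigD1 [set u; w]) //= big1 ?addr0; last first.
  by move=> e /andP[_ ne]; rewrite (side_step uw) ?subrr // eq_sym.
have wt0 : wt [set u; w] != 0 by rewrite gt_eqF ?wt_gt0.
rewrite -mulrBl mulrCA divff // mulr1 (vol_sideC uw) (sideC uw) !inE negbK.
by case: (connect _ _ _) => /=; rewrite ?(mul1r, mul0r, sub0r, subr0).
Qed.

Hypothesis G_gt1 : (1 < #|vert G|)%N.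

Lemma has_neighbour u : exists w, adj u w.
Proof.
have /card_gt0P[x] : (0 < #|[set~ u]|)%N by rewrite cardsC1; lia.
by rewrite !inE => /branch_exists[w uw _]; exists w.
Qed.

Lemma wdeg_gt0 u : 0 < wdeg u.
Proof.
have [w uw] := has_neighbour u.
rewrite /wdeg (bigD1 w) //= ltr_wpDr ?wt_gt0 //.
by apply: sumr_ge0 => x /andP[ux _]; exact/ltW/wt_gt0.
Qed.

Lemma tree_trans1 u : \sum_w trans u w = 1.
Proof.
rewrite /trans -big_mkcond -mulr_suml divff //.
by rewrite gt_eqF // wdeg_gt0.
Qed.

Lemma tree_hit_poisson v u : u != v -> tree_hit v u = 1 + \sum_w trans u w * tree_hit v w.
Proof.
move=> uv; have d0 : wdeg u != 0 by rewrite gt_eqF ?wdeg_gt0.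
have vE (V : nmodType) (f : vert G -> V) : \sum_(x in setT) f x = \sum_x f x.
  by apply: eq_bigl => x; rewrite inE.
(* Exactly one branch at [u] contains [v], so the sum is the total volume minus that of all
   branches; what remains is the degree of [u]. *)
have key : \sum_(w | adj u w) wt [set u; w] * (tree_hit v u - tree_hit v w) = wdeg u.
  have one : \sum_(w | adj u w) (v \in side [set u; w] w)%:R = 1 :> R.
    have : \sum_x (x == v)%:R = 1 :> R.
      by rewrite (bigD1 v) //= eqxx big1 ?addr0 // => x /negPf ->.
    rewrite (sum_branches _ u) (negPf uv) add0r => H; rewrite -[RHS]H.
    apply: eq_bigr => w _; case: (boolP (v \in _)) => vw.
      by rewrite (bigD1 v) //= eqxx big1 ?addr0 // => x /andP[_ /negPf ->].
    by rewrite big1 // => x xw; case: eqP => // xv; rewrite -xv xw in vw.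
  under eq_bigr => w uw do rewrite tree_hit_sub //.
  by rewrite sumrB -mulr_suml one mul1r {1}/vol vE (sum_branches wdeg u) addrK.
have -> : \sum_w trans u w * tree_hit v w =
    (wdeg u)^-1 * \sum_(w | adj u w) wt [set u; w] * tree_hit v w.
  rewrite mulr_sumr [RHS]big_mkcond; apply: eq_bigr => w _.
  by rewrite /trans /wdeg; case: ifP => _; rewrite ?mul0r // mulrAC mulrC.
move: key; under eq_bigr => w _ do rewrite mulrBr.
rewrite sumrB -mulr_suml -/(wdeg u) => key.
apply: (mulfI d0); rewrite mulrDr mulrA divff // mul1r mulr1 -[X in _ = X + _]key subrK //.
Qed.

Lemma tree_hit_ge0 v u : 0 <= tree_hit v u.
Proof.
apply: sumr_ge0 => e eG; apply: divr_ge0; last exact/ltW/wt_gt0.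
by rewrite mulr_ge0 ?vol_ge0.
Qed.

Lemma hitting_time_tree u v : hitting_time u v = (tree_hit v u)%:E.
Proof.
apply: hitting_time_poisson => [x||x|x _].
- exact: tree_hit_ge0.
- by apply: big1 => e _; rewrite side_refl !mul0r.
- exact: tree_hit_poisson.
- exact: tree_trans1.
Qed.

(** The minimum does not depend on the end picked when [e] is an edge of a tree; the value 0 is for
    sets without elements. *)
Definition cut_size e : nat :=
  if [pick x in e] is Some x then minn #|side e x| #|~: side e x| else 0.

Lemma cut_sizeE u w : adj u w ->
  cut_size [set u; w] = minn #|side [set u; w] u| #|side [set u; w] w|.
Proof.
move=> uw; rewrite /cut_size (sideC uw); case: pickP => [x|/(_ u)]; last by rewrite !inE eqxx.
by rewrite !inE => /orP[] /eqP -> //; rewrite (sideC uw) setCK minnC.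
Qed.

Lemma card_sides u w : adj u w ->
  (#|side [set u; w] u| + #|side [set u; w] w|)%N = #|vert G|.
Proof. by move=> uw; rewrite (sideC uw) cardsC. Qed.

Lemma cut_mul u w : adj u w ->
  (cut_size [set u; w] * (#|vert G| - cut_size [set u; w]))%N =
  (#|side [set u; w] u| * #|side [set u; w] w|)%N.
Proof.
move=> uw; rewrite cut_sizeE // -(card_sides uw) /minn.
by case: ifP => _; rewrite ?addnK ?addKn // mulnC.
Qed.

Lemma sum_tree_hit : \sum_u \sum_v tree_hit v u =
  vol setT * \sum_(e in edges G) (cut_size e * (#|vert G| - cut_size e))%:R / wt e.
Proof.
transitivity (\sum_(e in edges G) \sum_u #|~: side e u|%:R * vol (side e u) / wt e).
  under eq_bigr => u _ do rewrite exchange_big.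
  rewrite exchange_big; apply: eq_bigr => e _; apply: eq_bigr => u _ /=.
  rewrite -!mulr_suml; congr (_ * _ / _); rewrite -sum1_card natr_sum [RHS]big_mkcond /=.
  by apply: eq_bigr => v _; rewrite in_setC; case: (v \in side e u).
(* If the edge has sides A and B, the starting points in A contribute |A| |B| vol A and those in B
   contribute |B| |A| vol B. *)
rewrite mulr_sumr; apply: eq_bigr => _ /edge_ends[a [b [ab ->]]].
rewrite -mulr_suml mulrA; congr (_ / _); rewrite cut_mul // (sum_sides _ ab).
rewrite (eq_bigr (fun=> #|side [set a; b] b|%:R * vol (side [set a; b] a))); last first.
  by move=> x xa; rewrite (side_eq xa) (sideC ab).
rewrite [X in _ + X](eq_bigr (fun=> #|side [set a; b] a|%:R * vol (side [set a; b] b))); last first.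
  by move=> x xb; rewrite (side_eq xb) (sideC ab) setCK.
rewrite !sumr_const -[X in X + _]mulr_natl -[X in _ + X]mulr_natl (vol_sideC ab) natrM; ring.
Qed.

Lemma avg_hitting_time_tree : avg_hitting_time G =
  ((#|vert G| ^ 2)%:R^-1 * (vol setT *
   \sum_(e in edges G) (cut_size e * (#|vert G| - cut_size e))%:R / wt e))%:E.
Proof.
rewrite /avg_hitting_time -sum_tree_hit EFinM; congr (_ * _)%E.
rewrite -sumEFin; apply: eq_bigr => u _; rewrite -sumEFin.
by apply: eq_bigr => v _; rewrite hitting_time_tree.
Qed.

Lemma vol_setT : vol setT = 2 * \sum_(e in edges G) wt e.
Proof.
rewrite /vol mulr_sumr big_mkcond.
under eq_bigr => x _ do rewrite inE.
(* Handshake argument: each edge comes from exactly two ordered pairs of adjacent vertices. *)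
rewrite pair_big_dep /= (partition_big (fun p => [set p.1; p.2]) (mem (edges G))) //=.
apply: eq_bigr => _ /edge_ends[a [b [ab ->]]].
rewrite (eq_bigl (mem [set (a, b); (b, a)])) => [|[x y]].
  rewrite big_setU1 ?big_set1 /= ?inE ?xpair_eqE; last by rewrite (negPf (adj_neq ab)).
  by rewrite [[set b; a]]setUC; ring.
rewrite !inE !xpair_eqE /=; apply/andP/orP => [[xy /eqP E]|].
  have : a \in [set x; y] by rewrite E set21.
  have : b \in [set x; y] by rewrite E set22.
  move: (adj_neq ab); rewrite !inE => ne /orP[] /eqP bE /orP[] /eqP aE.
  - by rewrite aE bE eqxx in ne.
  - by right; rewrite aE bE !eqxx.
  - by left; rewrite aE bE !eqxx.
  - by rewrite aE bE eqxx in ne.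
by case=> /andP[/eqP-> /eqP->]; rewrite ?ab 1?setUC 1?adj_sym.
Qed.

End Sides.

(** * Edges whose removal leaves two large components *)

Section Cuts.
Variables (R : realType) (G : wgraph R).
Implicit Types (u v w x y z r : vert G) (e f : {set vert G}).
Hypothesis G_tree : is_tree G.

(* The first vertex on the way from [x] to the root [r]; junk for [x = r].      *)
Definition parent r x : vert G := odflt x [pick w | adj x w & r \in side [set x; w] w].

Lemma parentP r x : x != r -> adj x (parent r x) /\ r \in side [set x; parent r x] (parent r x).
Proof.
rewrite eq_sym => /(branch_exists G_tree)[w xw rw]; rewrite /parent.
by case: pickP => [z /andP[]//|/(_ w)]; rewrite xw rw.
Qed.

Lemma parentE r x w : adj x w -> r \in side [set x; w] w -> parent r x = w.
Proof.
move=> xw rw; have xr : x != r.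
  by apply: contraTneq rw => <-; rewrite sideC // inE side_refl.
have [xp rp] := parentP xr; exact: branch_unique xp xw rp rw.
Qed.

Lemma parent_inj r x y : x != r -> y != r ->
  [set x; parent r x] = [set y; parent r y] -> x = y.
Proof.
move=> /parentP[xp rp] /parentP[yp rp'] E.
have : x \in [set y; parent r y] by rewrite -E set21.
rewrite !inE => /orP[/eqP//|/eqP xE].
have : y \in [set x; parent r x] by rewrite E set21.
rewrite !inE => /orP[/eqP//|/eqP yE].
rewrite -yE in xp rp; rewrite -xE setUC in rp'.
by move: rp; rewrite sideC // inE rp'.
Qed.

(** Every edge is the first one on the way to the root from its end farther from [r]; with
    [parent_inj] this counts edges by non-root vertices. *)
Lemma edges_parent r : edges G = [set [set x; parent r x] | x in [set~ r]].
Proof.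
apply/setP => e; apply/idP/imsetP => [/edge_ends[x [y [xy ->]]]|[x]]; last first.
  by rewrite !inE => /parentP[xp _] ->.
have [rx|] := boolP (r \in side [set x; y] x); last rewrite -in_setC -sideC // => ry.
  have yx : adj y x by rewrite adj_sym.
  rewrite setUC in rx; exists y; last by rewrite (parentE yx rx) setUC.
  by rewrite !inE; apply: contraTneq rx => <-; rewrite sideC // inE side_refl.
exists x; last by rewrite (parentE xy ry).
by rewrite !inE; apply: contraTneq ry => <-; rewrite sideC // inE side_refl.
Qed.

Lemma card_edges : #|edges G| = #|vert G|.-1.
Proof.
have /card_gt0P[r _] := G_tree.1.1.
rewrite (edges_parent r) card_in_imset ?cardsC1 // => x y; rewrite !inE.
exact: parent_inj.
Qed.

(** With root [u], every other vertex of the side has its parent edge inside the side. *)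
Lemma card_inner u w : adj u w ->
  (#|side [set u; w] u|.-1 <=
   #|[set e in edges G | e \subset side [set u; w] u]|)%N.
Proof.
move=> uw; set X := side _ _.
have -> : #|X|.-1 = #|X :\ u| by rewrite (cardsD1 u X) side_refl.
rewrite -(@card_in_imset _ _ (fun x => [set x; parent u x])); last first.
  by move=> x y; rewrite !inE => /andP[xu _] /andP[yu _]; exact: parent_inj.
apply/subset_leq_card/subsetP => _ /imsetP[x /setD1P[xu xX] ->].
have [xp up] := parentP xu; rewrite inE; apply/andP; split => //.
rewrite subUset !sub1set xX /= /X -(side_eq xX).
rewrite -(@side_step _ _ _ x (parent u x)) ?side_refl //.
apply: contraTneq xX => E; have : x \in [set u; w] by rewrite -E set21.
by rewrite !inE (negPf xu) /= => /eqP ->; have := side_far G_tree uw; rewrite inE.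
Qed.

(** Orient the inner edge so that [b] is the end towards [w]: the component of [a] then avoids [b]
    and the whole side of [w]. *)
Lemma inner_side u w x y : adj u w -> adj x y ->
  [set x; y] \subset side [set u; w] u ->
  exists a b, [/\ adj a b, [set a; b] = [set x; y] &
                  side [set a; b] a \proper side [set u; w] u].
Proof.
move=> uw.
suff key a b : adj a b -> [set a; b] \subset side [set u; w] u ->
    w \in side [set a; b] b -> side [set a; b] a \proper side [set u; w] u.
  move=> xy sX; have [wx|wx] := boolP (w \in side [set x; y] x).
    exists y, x; rewrite adj_sym setUC; split=> //; rewrite setUC.
    by apply: key; rewrite 1?adj_sym 1?[[set y; x]]setUC.
  exists x, y; split => //; apply: key => //.
  by rewrite sideC // inE.
move=> ab; rewrite subUset !sub1set => /andP[aX bX] wb.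
have aN : a \notin side [set u; w] w by rewrite sideC // inE negbK.
have := side_sub (set21 a b) aN.
rewrite (side_eq wb) (sideC G_tree uw) (sideC G_tree ab) setCS => sub.
apply/properP; split => //; exists b => //; exact: side_far.
Qed.

Definition deep k := [set e in edges G | (k <= cut_size e)%N].

(** Among the sides of edges of cut size at least [k], take one minimal for inclusion below that of
    [u]; by [inner_side], an inner edge of cut size at least [k] would give a smaller one. *)
Lemma minimal_side k u w : adj u w -> (k <= cut_size [set u; w])%N ->
  exists a b, [/\ adj a b, side [set a; b] a \subset side [set u; w] u,
    (k <= #|side [set a; b] a|)%N &
    forall e, e \in edges G -> e \subset side [set a; b] a -> (cut_size e < k)%N].
Proof.
move=> uw kuw.
pose P X := [exists p : vert G * vert G,
  [&& adj p.1 p.2, X == side [set p.1; p.2] p.1 & (k <= cut_size [set p.1; p.2])%N]].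
have /minset_exists[X] : P (side [set u; w] u).
  by apply/existsP; exists (u, w); rewrite /= uw eqxx.
case/minsetP => /existsP[[a b] /= /and3P[ab /eqP-> kab]] Xmin sub.
exists a, b; split => //; first by apply: leq_trans kab _; rewrite cut_sizeE // geq_minl.
move=> _ /edge_ends[x [y [xy ->]]] /(inner_side ab xy)[a' [b' [ab' <- lt]]].
rewrite ltnNge; apply/negP => kab'.
move: (lt) => /proper_sub/Xmin E; move: lt; rewrite E ?properxx //.
by apply/existsP; exists (a', b'); rewrite /= ab' eqxx.
Qed.

(* A minimal side of size [> k] contains at least [k] edges, all shallow; there *)
(* is one on each side of a deep edge.                                          *)
Lemma card_deep k : (#|deep k.+1| <= #|vert G| - 1 - k.*2)%N.
Proof.
have [->|[_ /[!inE] /andP[/edge_ends[u [w [uw ->]]] kuw]]] := set_0Vmem (deep k.+1).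
  by rewrite cards0.
have wu : adj w u by rewrite adj_sym.
have [a [b [ab sub_u ka a_shallow]]] := minimal_side uw kuw.
have kwu : (k < cut_size [set w; u])%N by rewrite setUC.
have [c [d [cd sub_w kc c_shallow]]] := minimal_side wu kwu.
set A := [set e in edges G | e \subset side [set a; b] a].
set C := [set e in edges G | e \subset side [set c; d] c].
have kA : (k <= #|A|)%N by have := card_inner ab; rewrite -/A; lia.
have kC : (k <= #|C|)%N by have := card_inner cd; rewrite -/C; lia.
have dAC : A :&: C = set0.
  apply/setP => e; rewrite !inE; apply/negP => /andP[/andP[eG eA] /andP[_ eC]].
  have [x [y [_ ex]]] := edge_ends eG; have xe : x \in e by rewrite ex set21.
  have := subsetP sub_w x (subsetP eC x xe); have := subsetP sub_u x (subsetP eA x xe).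
  by rewrite [[set w; u]]setUC (sideC G_tree uw) in_setC => ->.
have sub : A :|: C \subset edges G :\: deep k.+1.
  apply/subsetP => e; rewrite !inE => /orP[] /andP[eG es]; rewrite eG /= andbT -leqNgt.
    exact: a_shallow.
  exact: c_shallow.
have := subset_leq_card sub; rewrite cardsU dAC cards0 subn0.
have sdE : deep k.+1 \subset edges G by apply/subsetP => e; rewrite !inE => /andP[].
have := subset_leq_card sdE.
rewrite cardsD (setIidPr sdE) card_edges; lia.
Qed.

Lemma cut_size_gt0 e : e \in edges G -> (0 < cut_size e)%N.
Proof.
move=> /edge_ends[u [w [uw ->]]]; rewrite cut_sizeE // leq_min.
by apply/andP; split; apply/card_gt0P; [exists u | exists w]; rewrite side_refl.
Qed.

Lemma side_has_leaf u w : adj u w ->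
  exists a b, [/\ adj a b, a \in side [set u; w] u & side [set a; b] a = [set a]].
Proof.
(* With [k] = 1 the minimal side contains no edge at all, hence a single vertex. *)
move=> uw; have [a [b [ab sub _ shallow]]] := minimal_side uw (cut_size_gt0 uw).
exists a, b; split => //; first by apply: (subsetP sub); rewrite side_refl.
apply/eqP; rewrite eq_sym eqEcard sub1set side_refl cards1 /=.
have := card_inner ab; rewrite (_ : [set _ in _ | _] = set0) ?cards0; first lia.
apply/setP => e; rewrite !inE; apply/negP => /andP[eG /(shallow _ eG)].
by have := cut_size_gt0 eG; lia.
Qed.

Lemma leaf_neighbour a b w : adj a b -> side [set a; b] a = [set a] -> adj a w -> w = b.
Proof.
move=> ab a_leaf aw; apply/eqP/negPn/negP => wb.
have : w \in side [set a; b] a.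
  rewrite -(@side_step _ _ _ a w) ?side_refl //.
  apply: contra wb => /eqP E; have : w \in [set a; b] by rewrite -E set22.
  by rewrite !inE [w == a]eq_sym (negPf (adj_neq aw)).
by rewrite a_leaf inE eq_sym (negPf (adj_neq aw)).
Qed.

(** Each branch at [u] contains a leaf, whose pendant edge has cut size at most 1; distinct branches
    yield distinct edges. *)
Lemma degree_le u : (#|[set w | adj u w]| <= #|edges G :\: deep 2|)%N.
Proof.
have /fin_all_exists[l lP] w : exists e, adj u w -> exists a b,
    [/\ e = [set a; b], adj a b, a \in side [set u; w] w & side [set a; b] a = [set a]].
  have [uw|] := boolP (adj u w); last by exists set0.
  have wu : adj w u by rewrite adj_sym.
  have [a [b [ab aw aE]]] := side_has_leaf wu.
  by exists [set a; b] => _; exists a, b; rewrite [[set u; w]]setUC.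
rewrite -(@card_in_imset _ _ l) => [|w w']; last first.
  rewrite !inE => uw uw'; have [a [b [-> ab aw aE]]] := lP w uw.
  have [c [d [-> cd cw cE]]] := lP w' uw' => abcd.
  have [ac|ac] := eqVneq a c; first by rewrite ac in aw; exact: branch_unique uw uw' aw cw.
  (* If two branches shared a pendant edge with different leaves, both of its ends would be leaves
     and the tree would have no room for [u]. *)
  have cb : c = b.
    have : c \in [set a; b] by rewrite abcd set21.
    by rewrite !inE [c == a]eq_sym (negPf ac) => /eqP.
  have uNc : u != c.
    by apply: contraTneq cw => <-; rewrite sideC // inE side_refl.
  have uNa : u != a.
    by apply: contraTneq aw => <-; rewrite sideC // inE side_refl.
  have := sideC G_tree ab; rewrite aE abcd -cb cE => /setP/(_ u).
  by rewrite !inE (negPf uNa) (negPf uNc).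
apply/subset_leq_card/subsetP => _ /imsetP[w /[!inE] uw ->].
have [a [b [-> ab aw aE]]] := lP w uw.
by rewrite /adj in ab; rewrite ab andbT /= cut_sizeE // aE cards1 -ltnNge ltnS geq_minl.
Qed.

End Cuts.

(** * Paths *)

Section PathOfDegree.
Variables (R : realType) (G : wgraph R).
Implicit Types (u v w x y z r : vert G) (e f : {set vert G}).
Hypothesis G_tree : is_tree G.
Hypothesis G_gt1 : (1 < #|vert G|)%N.
Hypothesis deg_le2 : forall u, (#|[set w | adj u w]| <= 2)%N.

Section Leaf.
Variables r s : vert G.
Hypothesis rs : adj r s.
Hypothesis r_leaf : side [set r; s] r = [set r].

(* Rooting the tree at the leaf [r], the number of descendants of [x] increases *)
(* by exactly one from a vertex to its parent: it is the position on the path.  *)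
Let label x := if x == r then #|vert G| else #|side [set x; parent r x] x|.

Let label_parent x : x != r -> label (parent r x) = (label x).+1.
Proof.
move=> xr; have [xw rw] := parentP G_tree xr; set w := parent r x in xw rw *.
have wx : adj w x by rewrite adj_sym.
(* Count the vertices by the branches at [w]: besides the way to the root, the degree bound leaves
   only the branch of [x]. *)
have := sum_branches G_tree (fun=> 1%N) w; rewrite sum1_card.
under eq_bigr => y _ do rewrite sum1_card.
rewrite {2}/label (negPf xr) -/w {1}/label; case: eqVneq => [wr|wNr] cardG.
  rewrite -[LHS]/(#|vert G|) cardG (big_pred1 x) ?[[set w; x]]setUC // => y /=.
  apply/idP/eqP => [|->//]; rewrite wr in wx *.
  by move=> /(leaf_neighbour rs r_leaf)->; rewrite (leaf_neighbour rs r_leaf wx).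
have [wz rz] := parentP G_tree wNr; set z := parent r w in wz rz *.
have xz : x != z.
  have zw : adj z w by rewrite adj_sym.
  by apply: contraTneq rw => ->; rewrite sideC // in_setC negbK setUC.
have N : [set y | adj w y] = [set x; z].
  apply/eqP; rewrite eq_sym eqEcard cards2 xz deg_le2 andbT.
  by rewrite subUset !sub1set !inE wx wz.
rewrite (eq_bigl (mem [set x; z])) in cardG; last first.
  by move=> y; rewrite -[RHS]/(y \in [set x; z]) -N [RHS]inE.
rewrite big_setU1 ?big_set1 ?inE //= in cardG.
have := card_sides G_tree wz; rewrite [[set x; w]]setUC; move: cardG; rewrite -cardsT cardsT.
lia.
Qed.

Let child x : (1 < label x)%N -> exists2 w, w != r & parent r w = x.
Proof.
rewrite /label; case: eqVneq => [->|xr] lx.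
  exists s; first by rewrite eq_sym (adj_neq rs).
  by apply: parentE; rewrite 1?adj_sym // side_refl.
have [xz rz] := parentP G_tree xr; set z := parent r x in lx xz rz.
have [y /setD1P[yx yX]] : exists y, y \in side [set x; z] x :\ x.
  by apply/set0Pn; rewrite -card_gt0; have := cardsD1 x (side [set x; z] x); rewrite side_refl; lia.
have [w xw yw] := branch_exists G_tree yx.
have wz : w != z.
  by apply: contraTneq yw => ->; rewrite sideC // in_setC yX.
have rw : r \in side [set w; x] x.
  rewrite setUC; apply: contraR wz; rewrite -in_setC -sideC // => rw.
  by rewrite (branch_unique G_tree xw xz rw rz).
have wx : adj w x by rewrite adj_sym.
exists w; last exact: parentE.
apply/eqP => wr; rewrite wr in rw wx.
by move: rw; rewrite sideC // inE side_refl.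
Qed.

Let label_onto k : (k < #|vert G|)%N -> exists x, label x = (#|vert G| - k)%N.
Proof.
elim: k => [|k IH] kG; first by exists r; rewrite /label eqxx subn0.
have [x lx] := IH (ltnW kG).
have [|w wr wx] := @child x; first by rewrite lx; lia.
by exists w; have := label_parent wr; rewrite wx lx; lia.
Qed.

Let label_inj : injective label.
Proof.
(* The n labels cover 1, ..., n, so none is repeated. *)
apply/injectiveP; rewrite /injectiveb /dinjectiveb.
apply: (@leq_size_uniq _ (iota 1 #|vert G|)); first exact: iota_uniq.
  move=> i; rewrite mem_iota => /andP[i0 iG].
  have [|x lx] := @label_onto (#|vert G| - i)%N; first by lia.
  by apply/mapP; exists x; [rewrite mem_enum | rewrite lx; lia].
by rewrite size_map size_iota -cardE.
Qed.

Let label_bound x : (1 <= label x <= #|vert G|)%N.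
Proof.
rewrite /label; case: ifP => _; first by rewrite leqnn andbT; lia.
by rewrite max_card andbT; apply/card_gt0P; exists x; rewrite side_refl.
Qed.

Lemma path_of_degree_leaf : exists p : nat -> vert G, path_labelling #|vert G| p.
Proof.
pose p i := odflt r [pick x | label x == i].
have pK x : p (label x) = x.
  rewrite /p; case: pickP => [y /eqP/label_inj//|/(_ x)]; by rewrite eqxx.
have lK i : (1 <= i <= #|vert G|)%N -> label (p i) = i.
  move=> iG; have [|x lx] := @label_onto (#|vert G| - i)%N; first by lia.
  have -> : i = label x by lia.
  by rewrite pK.
exists p; split=> [i j iG jG pij|x|e].
- by rewrite -(lK i) // pij lK.
- by exists (label x); rewrite ?pK.
- split=> [|[i iG ->]].
    rewrite (edges_parent G_tree r) => /imsetP[x]; rewrite !inE => xr ->.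
    exists (label x); last by rewrite -label_parent // !pK.
    have := label_bound (parent r x); rewrite label_parent // => /andP[_ ->].
    by have /andP[-> _] := label_bound x.
  have pr : p i != r.
    have /lK lpi : (1 <= i <= #|vert G|)%N by lia.
    by apply/eqP => E; move: lpi; rewrite E /label eqxx; lia.
  have -> : p i.+1 = parent r (p i).
    by rewrite -[RHS]pK label_parent // lK //; lia.
  by have [] := parentP G_tree pr.
Qed.

End Leaf.

Lemma path_of_degree : exists p : nat -> vert G, path_labelling #|vert G| p.
Proof.
have /card_gt0P[u _] := ltnW G_gt1.
have [w uw] := has_neighbour G_tree G_gt1 u.
have [a [b [ab _ aE]]] := side_has_leaf G_tree uw.
exact: path_of_degree_leaf ab aE.
Qed.

End PathOfDegree.

(** * Cut sizes along a labelled path *)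

Section LabelledPath.
Variables (R : realType) (G : wgraph R) (n : nat) (p : nat -> vert G).
Hypothesis G_tree : is_tree G.
Hypothesis p_path : path_labelling n p.

Let p_inj i j : (1 <= i <= n)%N -> (1 <= j <= n)%N -> p i = p j -> i = j.
Proof. by case: p_path => inj _ _; exact: inj. Qed.

Lemma card_labelled_path : #|vert G| = n.
Proof.
have [_ onto _] := p_path.
rewrite -[RHS]card_ord -(@card_imset _ _ (fun i : 'I_n => p i.+1)) => [|i j pij].
  rewrite -cardsT; congr #|pred_of_set _|; apply/setP => x; rewrite inE; symmetry.
  apply/imsetP; have [i iG ->] := onto x.
  have i_lt : (i.-1 < n)%N by lia.
  by exists (Ordinal i_lt) => //=; rewrite prednK //; lia.
apply: val_inj; apply: succn_inj; apply: p_inj pij; have := ltn_ord i; have := ltn_ord j; lia.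
Qed.

Lemma labelled_adj i : (1 <= i < n)%N -> adj (p i) (p i.+1).
Proof. by case: p_path => _ _ E iG; apply/E; exists i. Qed.

Lemma labelled_edge_inj i j : (1 <= i < n)%N -> (1 <= j < n)%N ->
  [set p i; p i.+1] = [set p j; p j.+1] -> i = j.
Proof.
move=> iG jG E.
have : p i \in [set p j; p j.+1] by rewrite -E set21.
have : p j \in [set p i; p i.+1] by rewrite E set21.
rewrite !inE => /orP[] /eqP /p_inj h1 /orP[] /eqP /p_inj h2; lia.
Qed.

Lemma cut_size_labelled i : (1 <= i < n)%N -> cut_size [set p i; p i.+1] = path_c n i.
Proof.
move=> iG; set e := [set p i; p i.+1].
have stepE j : (1 <= j < n)%N -> j != i -> side e (p j.+1) = side e (p j).
  move=> jG ji; apply: side_step; first exact: labelled_adj.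
  by apply: contra ji => /eqP/labelled_edge_inj->.
have lower k : (k < i)%N -> p (i - k)%N \in side e (p i).
  elim: k => [|k IH] ki; first by rewrite subn0 side_refl.
  rewrite -(side_eq (IH (ltnW ki))) (_ : (i - k)%N = (i - k.+1).+1); last by lia.
  by rewrite stepE ?side_refl //; lia.
have upper k : (i.+1 + k <= n)%N -> p (i.+1 + k)%N \in side e (p i.+1).
  elim: k => [|k IH] ki; first by rewrite addn0 side_refl.
  have ki' : (i.+1 + k <= n)%N by lia.
  by rewrite -(side_eq (IH ki')) -stepE ?addnS ?side_refl //; lia.
(* The two sides have at least i and n - i vertices, and n in total, so both bounds are
   equalities. *)
have le1 : (i <= #|side e (p i)|)%N.
  rewrite -[leqLHS]card_ord -(@card_imset _ _ (fun k : 'I_i => p (i - k)%N)).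
    by apply/subset_leq_card/subsetP => _ /imsetP[k _ ->]; exact: lower.
  move=> k l /p_inj h; apply: val_inj; have := ltn_ord k; have := ltn_ord l.
  by move=> ? ?; move: h => /=; lia.
have le2 : (n - i <= #|side e (p i.+1)|)%N.
  rewrite -[leqLHS]card_ord -(@card_imset _ _ (fun k : 'I_(n - i) => p (i.+1 + k)%N)).
    by apply/subset_leq_card/subsetP => _ /imsetP[k _ ->]; apply: upper; have := ltn_ord k; lia.
  move=> k l /p_inj h; apply: val_inj; have := ltn_ord k; have := ltn_ord l.
  by move=> ? ?; move: h => /=; lia.
have := card_sides G_tree (labelled_adj iG); rewrite -/e card_labelled_path => sumE.
rewrite cut_sizeE ?labelled_adj // -/e /path_c; congr minn; lia.
Qed.

End LabelledPath.

(** * Optimality of polarized paths *)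

Lemma sum_image (R : realType) (V : nmodType) (I : finType) (A : {set I}) (f : I -> R)
  (F : R -> V) : \sum_(y <- [seq f x | x in A]) F y = \sum_(x in A) F (f x).
Proof. by rewrite big_map big_enum. Qed.

Definition top_part (R : realType) (I : finType) (A B : {set I}) (f : I -> R) :=
  forall b c, b \in B -> c \in A :\: B -> f c <= f b.

(* With [t] the least value of [g] on [B], both sums are compared with          *)
(* [#|B| * t + sum of max (value - t, 0)], which only depends on the multiset.  *)
Lemma top_part_sum (R : realType) (I J : finType) (A A' : {set I}) (B B' : {set J})
    (f : I -> R) (g : J -> R) :
  perm_eq [seq f x | x in A] [seq g y | y in B] ->
  (forall y, y \in B -> 0 < g y) ->
  A' \subset A -> B' \subset B -> (#|A'| <= #|B'|)%N -> top_part B B' g ->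
  \sum_(x in A') f x <= \sum_(y in B') g y /\
  (\sum_(x in A') f x = \sum_(y in B') g y -> #|A'| = #|B'| /\ top_part A A' f).
Proof.
move=> fg g_gt0 sA sB leAB topB.
have [B0|[b0 b0B]] := set_0Vmem B'.
  move: leAB; rewrite B0 cards0 leqn0 cards_eq0 => /eqP ->.
  by rewrite !big_set0 cards0; split=> // _; split=> // b c; rewrite inE.
have [b bB bmin] := arg_minP g b0B.
set t := g b in bmin.
pose m (y : R) := Num.max (y - t) 0.
have m_ge0 y : 0 <= m y by rewrite /m le_max lexx orbT.
have m_ge y : y - t <= m y by rewrite /m le_max lexx.
have mE : \sum_(x in A) m (f x) = \sum_(y in B) m (g y).
  by rewrite -!sum_image (perm_big _ fg).
have t_gt0 : 0 < t by apply: g_gt0; exact: (subsetP sB).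
have sumB : \sum_(y in B') g y = #|B'|%:R * t + \sum_(x in A) m (f x).
  rewrite mE [in RHS](big_setID B') /= (setIidPr sB) [X in _ + (_ + X)]big1 ?addr0; last first.
    by move=> c cB; apply/max_idPr; rewrite subr_le0; exact: topB.
  rewrite mulr_natl -sumr_const -big_split; apply: eq_bigr => y yB /=.
  by rewrite /m (max_idPl _) ?subr_ge0 ?bmin // addrC subrK.
have sumA : \sum_(x in A') f x = #|A'|%:R * t + \sum_(x in A') (f x - t).
  rewrite mulr_natl -sumr_const -big_split; apply: eq_bigr => y yB /=.
  by rewrite addrC subrK.
have d1 : #|A'|%:R * t <= #|B'|%:R * t by rewrite ler_pM2r // ler_nat.
have d2 : \sum_(x in A') (f x - t) <= \sum_(x in A') m (f x) by apply: ler_sum.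
have d3 : \sum_(x in A) m (f x) = \sum_(x in A') m (f x) + \sum_(x in A :\: A') m (f x).
  by rewrite (big_setID A') /= (setIidPr sA).
have d4 : 0 <= \sum_(x in A :\: A') m (f x) by apply: sumr_ge0.
rewrite sumA sumB d3; split=> [|E]; first by lra.
(* Equality of the sums makes [d1], [d2] and [d4] equalities: values on [A'] are at least t, those
   outside at most t. *)
have e1 : #|A'|%:R * t = #|B'|%:R * t by lra.
have e2 : \sum_(x in A') (m (f x) - (f x - t)) = 0 by rewrite sumrB; lra.
have e3 : \sum_(x in A :\: A') m (f x) = 0 by lra.
split; first by apply/eqP; rewrite -(eqr_nat R); apply/eqP; apply: mulIf e1; rewrite gt_eqF.
move=> x c xA cA.
have mx : m (f x) - (f x - t) = 0.
  by apply: (psumr_eq0P _ e2) xA => i _; rewrite subr_ge0.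
have mc : m (f c) = 0 by apply: (psumr_eq0P _ e3) cA => i _.
by have := m_ge0 (f x); have := m_ge (f c); lra.
Qed.

(** The sum telescopes: n - 1 - 2k is the increment of k(n - k). The bound on [a] keeps the
    truncated subtractions exact. *)
Lemma mul_subn_sum (n a : nat) : (a.*2 <= n)%N ->
  (a * (n - a))%N = (\sum_(k < n | (k < a)%N) (n - 1 - k.*2))%N.
Proof.
move=> an; have le_an : (a <= n)%N by lia.
rewrite -(big_ord_widen n (fun k => n - 1 - k.*2)%N le_an) {le_an}.
elim: a an => [|a IH] an; first by rewrite big_ord0.
rewrite big_ord_recr /= -IH; last by lia.
have [b ->] : exists b, n = (b + a.*2.+2)%N by exists (n - a.*2.+2)%N; lia.
rewrite -addnn; nia.
Qed.

Section Weighted.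
Variable R : realType.
Implicit Type G T P : wgraph R.

Definition cut_sum G : R :=
  \sum_(e in edges G) (cut_size e * (#|vert G| - cut_size e))%:R / wt e.

Lemma double_cut_size G (e : {set vert G}) : ((cut_size e).*2 <= #|vert G|)%N.
Proof.
rewrite /cut_size; case: pickP => [x _|//].
by have := cardsC (side e x); rewrite /minn; case: ifP; lia.
Qed.

Lemma cut_sum_deep G : cut_sum G =
  \sum_(k < #|vert G|) (#|vert G| - 1 - k.*2)%:R * \sum_(e in deep G k.+1) (wt e)^-1.
Proof.
transitivity (\sum_(e in edges G) \sum_(k < #|vert G| | (k < cut_size e)%N)
    (#|vert G| - 1 - k.*2)%:R / wt e).
  apply: eq_bigr => e _; rewrite mul_subn_sum ?double_cut_size //.
  by rewrite natr_sum mulr_suml.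
rewrite (exchange_big_dep xpredT) //=; apply: eq_bigr => k _.
by rewrite mulr_sumr; apply: eq_bigl => e; rewrite !inE.
Qed.

(** The deep edges of a path are the central ones, from index k + 1 to n - 1 - k, and polarization
    gives them the smallest weights. *)
Lemma polarized_deep P k : is_tree P -> is_polarized_path P ->
  (#|vert P| - 1 - k.*2 <= #|deep P k.+1|)%N /\
  top_part (edges P) (deep P k.+1) (fun e => (wt e)^-1).
Proof.
move=> P_tree [n [p [pP p_pol]]]; have nE := card_labelled_path pP; rewrite nE.
have cE i iG := @cut_size_labelled _ _ n p P_tree pP i iG.
have adjp := labelled_adj pP.
split.
  rewrite -[leqLHS]card_ord -(@card_imset _ _ (fun i : 'I_(n - 1 - k.*2) =>
    [set p (k.+1 + i)%N; p (k.+1 + i)%N.+1])) => [|i j E].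
    apply/subset_leq_card/subsetP => _ /imsetP[i _ ->].
    have i_lt := ltn_ord i; have iG : (1 <= k.+1 + i < n)%N by lia.
    by rewrite inE [_ \in _](adjp _ iG) cE // /path_c leq_min; lia.
  have i_lt := ltn_ord i; have j_lt := ltn_ord j; apply: val_inj.
  have : (k.+1 + i = k.+1 + j)%N by apply: (labelled_edge_inj pP _ _ E); lia.
  by move=> /addnI.
have [_ _ pE] := pP.
move=> b c; rewrite !inE => /andP[/pE[j jG ->]]; rewrite cE // => kj.
case/andP=> + cG; rewrite cG -ltnNge; move: cG => /pE[i iG ->]; rewrite cE // => ik.
rewrite lef_pV2 ?posrE; try by apply: wt_gt0; exact: adjp.
by apply: p_pol => //; lia.
Qed.

Lemma card_vert_perm T P : is_tree T -> is_tree P ->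
  perm_eq [seq wt e | e in edges T] [seq wt e | e in edges P] -> #|vert T| = #|vert P|.
Proof.
move=> T_tree P_tree /perm_size; rewrite !size_map -!cardE !card_edges //.
by have := T_tree.1.1; have := P_tree.1.1; lia.
Qed.

Lemma polarized_path_max T P : is_tree T -> is_tree P -> (1 < #|vert T|)%N ->
  perm_eq [seq wt e | e in edges T] [seq wt e | e in edges P] -> is_polarized_path P ->
  cut_sum T <= cut_sum P /\ (cut_sum T = cut_sum P -> is_polarized_path T).
Proof.
move=> T_tree P_tree T_gt1 TP P_pol.
have nE := card_vert_perm T_tree P_tree TP.
have TPV : perm_eq [seq (wt e)^-1 | e in edges T] [seq (wt e)^-1 | e in edges P].
  by have := perm_map (@GRing.inv R) TP; rewrite -!map_comp.
have subE G k : deep G k \subset edges G.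
  by apply/subsetP => e; rewrite inE => /andP[].
have cmp k : (k.*2.+1 < #|vert T|)%N ->
    \sum_(e in deep T k.+1) (wt e)^-1 <= \sum_(e in deep P k.+1) (wt e)^-1 /\
    (\sum_(e in deep T k.+1) (wt e)^-1 = \sum_(e in deep P k.+1) (wt e)^-1 ->
     #|deep T k.+1| = #|deep P k.+1| /\
     top_part (edges T) (deep T k.+1) (fun e => (wt e)^-1)).
  move=> kn; have [leP topP] := polarized_deep k P_tree P_pol.
  apply: top_part_sum TPV _ (subE _ _) (subE _ _) _ topP.
    by move=> e eP; rewrite invr_gt0 wt_gt0.
  by apply: leq_trans leP; rewrite -nE; exact: card_deep.
have diff_ge0 (k : 'I_#|vert T|) : 0 <= (#|vert T| - 1 - k.*2)%:R *
    (\sum_(e in deep P k.+1) (wt e)^-1 - \sum_(e in deep T k.+1) (wt e)^-1).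
  have [kn|kn] := ltnP k.*2.+1 #|vert T|.
    by rewrite mulr_ge0 // subr_ge0; exact: (cmp k kn).1.
  by rewrite (_ : (_ - _ - _)%N = 0%N) ?mul0r //; lia.
have diffE : cut_sum P - cut_sum T = \sum_(k < #|vert T|) (#|vert T| - 1 - k.*2)%:R *
    (\sum_(e in deep P k.+1) (wt e)^-1 - \sum_(e in deep T k.+1) (wt e)^-1).
  rewrite !cut_sum_deep -nE -sumrB; apply: eq_bigr => k _.
  by rewrite mulrBr.
split=> [|TPE]; first by rewrite -subr_ge0 diffE; apply: sumr_ge0.
have deepE k : (k.*2.+1 < #|vert T|)%N -> #|deep T k.+1| = #|deep P k.+1| /\
    top_part (edges T) (deep T k.+1) (fun e => (wt e)^-1).
  move=> kn; apply: (cmp k kn).2; apply/esym/eqP; rewrite -subr_eq0.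
  have k_lt : (k < #|vert T|)%N by lia.
  move: diffE; rewrite TPE subrr => /esym sum0.
  (* A vanishing sum of nonnegative terms: the slice k is tight because its coefficient is
     positive. *)
  have /(_ (Ordinal k_lt) isT)/eqP := psumr_eq0P (fun i _ => diff_ge0 i) sum0.
  have c_neq0 : (#|vert T| - 1 - k.*2 == 0)%N = false by apply/eqP; lia.
  by rewrite /= mulf_eq0 pnatr_eq0 c_neq0.
have deg_le2 (u : vert T) : (#|[set w | adj u w]| <= 2)%N.
  apply: leq_trans (degree_le T_tree u) _.
  (* The slice k = 1 leaves at most two pendant edges; with at most three vertices there are at most
     two edges anyway. *)
  have [n4|n4] := ltnP 3 #|vert T|.
    have [E _] := deepE 1%N n4; have [leP _] := polarized_deep 1%N P_tree P_pol.
    by rewrite cardsD (setIidPr (subE _ _)) card_edges // E; lia.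
  by apply: leq_trans (subset_leq_card (subsetDl _ _)) _; rewrite card_edges //; lia.
have [p pT] := path_of_degree T_tree T_gt1 deg_le2.
exists #|vert T|, p; split=> // i j iG jG ij.
have adjp := labelled_adj pT; have cE := cut_size_labelled T_tree pT.
have j0 : (0 < path_c #|vert T| j)%N by rewrite /path_c; lia.
(* This slice separates the two edges: [e_j] is deep at its own level, while [e_i] is not. *)
have [|_ topT] := deepE (path_c #|vert T| j).-1; first by rewrite /path_c; lia.
have := topT [set p j; p j.+1] [set p i; p i.+1]; rewrite prednK // !inE.
rewrite [[set p j; _] \in _](adjp _ jG) [[set p i; _] \in _](adjp _ iG) !cE // leqnn /= -ltnNge ij.
move=> /(_ isT isT); rewrite lef_pV2 ?posrE //; by apply: wt_gt0; exact: adjp.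
Qed.

End Weighted.

(** * Trees given by a parent function *)

Lemma perm_enum_imset (I J : finType) (A : {pred I}) (f : I -> J) :
  {in A &, injective f} -> perm_eq (enum (f @: A)) [seq f x | x in A].
Proof.
move=> f_inj; apply: uniq_perm; first exact: enum_uniq.
  by rewrite map_inj_in_uniq ?enum_uniq // => x y; rewrite !mem_enum; exact: f_inj.
move=> y; rewrite mem_enum; apply/imsetP/mapP => -[x xA ->]; exists x => //.
  by rewrite mem_enum.
by rewrite -mem_enum.
Qed.

Section ParentGraph.
Variables (R : realType) (m : nat) (par : nat -> nat) (s : seq R).
Hypothesis par_le : forall i, (par i <= i)%N.
Hypothesis size_s : size s = m.
Hypothesis s_gt0 : forall x, x \in s -> 0 < x.

(** Vertex i + 1 hangs from [par i <= i]: a constant [par] gives a star, the identity a path. The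
    larger end identifies the edge, which is how [parent_wt] finds its weight. *)
Definition parent_edge (i : 'I_m) : {set 'I_m.+1} := [set lift ord0 i; inord (par i)].

Definition parent_wt (e : {set 'I_m.+1}) : R := nth 0 s (\max_(x in e) x).-1.

Let parK (i : 'I_m) : (inord (par i) : 'I_m.+1) = par i :> nat.
Proof. by rewrite inordK //; have := par_le i; have := ltn_ord i; lia. Qed.

Lemma max_parent_edge i : \max_(x in parent_edge i) (x : nat) = i.+1.
Proof.
have ne : lift ord0 i \notin [set (inord (par i) : 'I_m.+1)].
  by rewrite inE -val_eqE /= parK /bump /=; have := par_le i; lia.
rewrite /parent_edge big_setU1 //= big_set1 parK /bump /=.
by have := par_le i; lia.
Qed.

Lemma parent_wtE i : parent_wt (parent_edge i) = nth 0 s i.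
Proof. by rewrite /parent_wt max_parent_edge. Qed.

Let parent_edge_inj : injective parent_edge.
Proof.
by move=> i j E; apply/val_inj/succn_inj; rewrite -!max_parent_edge E.
Qed.

Let E := [set parent_edge i | i : 'I_m].

Let E_card2 e : e \in E -> #|e| = 2%N.
Proof.
case/imsetP => i _ ->; rewrite cards2 -val_eqE /= parK /bump /=.
by have := par_le i; case: eqP => //; lia.
Qed.

Let E_wt e : e \in E -> 0 < parent_wt e.
Proof.
by case/imsetP => i _ ->; rewrite parent_wtE s_gt0 // mem_nth // size_s.
Qed.

Definition parent_graph : wgraph R := WGraph E_card2 E_wt.

Let adj_lt (x y : vert parent_graph) : adj x y -> (y < x)%N -> y = par x.-1 :> nat.
Proof.
case/imsetP => i _ xyE yx.
have : x \in parent_edge i by rewrite -xyE set21.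
have : y \in parent_edge i by rewrite -xyE set22.
rewrite !inE -!val_eqE /= parK /bump /= => /orP[] /eqP y_eq /orP[] /eqP x_eq; move: yx; rewrite y_eq x_eq ?add1n //=.
- by rewrite ltnn.
- by have := par_le i; lia.
- by rewrite ltnn.
Qed.

Let parent_adj (i : 'I_m) : adj (inord (par i) : vert parent_graph) (lift ord0 i).
Proof. by rewrite /adj setUC; apply/imsetP; exists i. Qed.

Lemma parent_graph_tree : is_tree parent_graph.
Proof.
split.
  split; first by rewrite card_ord.
  have c0 (x : vert parent_graph) : connect (@adj _ parent_graph) ord0 x.
    have [k] := ubnP (x : nat); elim: k x => // k IH x; rewrite ltnS => xk.
    case: (unliftP ord0 x) => [i xE|->]; last exact: connect0.
    rewrite xE; apply: connect_trans (connect1 (parent_adj i)); apply: IH.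
    move: xk; rewrite xE /= parK /bump /=; exact: leq_ltn_trans (par_le i).
  move=> x y; apply: connect_trans (c0 y).
  by rewrite (sym_connect_sym (@adj_sym _ parent_graph)).
move=> c; case: c => [//|x0 c0] cyc.
(* Rotate the cycle to start at its largest vertex: both cyclic neighbours are smaller, hence equal
   to its parent, so the cycle has at most two vertices. *)
case: (arg_maxnP (P := mem (x0 :: c0)) (fun x : 'I_m.+1 => (x : nat)) (mem_head x0 c0)) => z zc zmax.
have [k p cE] := rot_to zc.
rewrite -(size_rot k); move: cyc; rewrite -(rot_ucycle k) cE.
case/lastP: p cE => [//|p y] cE; case: p cE => [//|x p] cE.
rewrite /ucycle /= rcons_path last_rcons => /andP[/andP[zx /andP[_ yz]]].
have inc w : w \in z :: rcons (x :: p) y -> (w <= z)%N.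
  by rewrite -cE mem_rot; exact: zmax.
have zy : adj z y by rewrite adj_sym.
have xlt : (x < z)%N.
  by rewrite ltn_neqAle inc ?inE ?eqxx ?orbT // andbT eq_sym; exact: adj_neq zx.
have ylt : (y < z)%N.
  by rewrite ltn_neqAle inc ?inE ?mem_rcons ?inE ?eqxx ?orbT // andbT eq_sym; exact: adj_neq zy.
have xy : x = y by apply: val_inj; rewrite /= (adj_lt zx xlt) (adj_lt zy ylt).
by rewrite xy mem_rcons inE eqxx /= andbF.
Qed.

Lemma perm_parent_graph : perm_eq [seq wt e | e in edges parent_graph] s.
Proof.
apply: (perm_trans (perm_map _ (perm_enum_imset (in2W parent_edge_inj)))).
rewrite -map_comp; apply/permP => a; congr count.
rewrite -[RHS](mkseq_nth 0) size_s /mkseq -val_enum_ord -map_comp enumT.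
apply: eq_map => i; exact: parent_wtE.
Qed.

End ParentGraph.

(** * Stars *)

(** Equal multisets of values allow a value-preserving matching of the indices, even when values
    repeat: [k] permutes the positions in the two enumerations. *)
Lemma perm_image_bij (R : realType) (I J : finType) (A : {set I}) (B : {set J})
    (f : I -> R) (g : J -> R) (y0 : J) :
  perm_eq [seq f x | x in A] [seq g y | y in B] ->
  exists h : I -> J, {in A &, injective h} /\
    {in A, forall x, h x \in B /\ g (h x) = f x}.
Proof.
move=> /(perm_iotaP 0)[k]; rewrite size_map => k_iota fE.
have size_k : size k = #|A| by rewrite -(size_map (nth 0 [seq g y | y in B])) -fE size_map -cardE.
have k_lt i : (i < #|A|)%N -> (nth 0%N k i < #|B|)%N.
  rewrite -size_k => /(mem_nth 0%N); rewrite (perm_mem k_iota) mem_iota -cardE.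
  by case/andP.
have k_uniq : uniq k by rewrite (perm_uniq k_iota) iota_uniq.
pose idx x := nth 0%N k (index x (enum A)).
have idx_lt x : x \in A -> (index x (enum A) < #|A|)%N.
  by move=> xA; rewrite cardE index_mem mem_enum.
exists (fun x => nth y0 (enum B) (idx x)); split=> [x y xA yA /eqP|x xA].
  rewrite nth_uniq -?cardE ?k_lt ?idx_lt ?enum_uniq // nth_uniq ?size_k ?idx_lt // => /eqP E.
  by rewrite -(nth_index x (_ : x \in enum A)) ?mem_enum // E nth_index ?mem_enum.
split; first by rewrite -mem_enum mem_nth // -cardE k_lt ?idx_lt.
have := congr1 (fun s => nth 0 s (index x (enum A))) fE.
rewrite (nth_map x) -?cardE ?idx_lt // nth_index ?mem_enum // => ->.
rewrite (nth_map 0%N) ?size_k ?idx_lt // (nth_map y0) // -cardE k_lt ?idx_lt //.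
Qed.

Section Stars.
Variable R : realType.
Implicit Type G T S : wgraph R.

Lemma star_perm T c : edges T = [set [set c; v] | v in [set~ c]] ->
  perm_eq [seq wt e | e in edges T] [seq wt [set c; v] | v in [set~ c]].
Proof.
move=> E; rewrite E; apply: (perm_trans (perm_map _ (perm_enum_imset _))).
  move=> x y; rewrite !inE => xc yc /setP/(_ x); rewrite !inE eqxx orbT (negPf xc) /=.
  by move/esym/eqP.
by rewrite -map_comp.
Qed.

Lemma star_wisom T S : #|vert T| = #|vert S| -> is_star T -> is_star S ->
  perm_eq [seq wt e | e in edges T] [seq wt e | e in edges S] -> wisom T S.
Proof.
move=> nE [c TE] [d SE] TS.
have := star_perm TE; rewrite perm_sym => leaves.
have {leaves TS} := perm_trans (perm_trans leaves TS) (star_perm SE).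
case/(perm_image_bij d) => h [h_inj hP].
pose phi x := if x == c then d else h x.
have phic : phi c = d by rewrite /phi eqxx.
have phi_off x : x != c -> phi x != d /\ wt [set d; phi x] = wt [set c; x].
  move=> xc; rewrite /phi (negPf xc); have [|] := hP x; first by rewrite !inE.
  by rewrite !inE.
have phi_inj : injective phi.
  move=> x y; have [->|xc] := eqVneq x c; have [->|yc] := eqVneq y c => //.
  - by rewrite phic => /esym/eqP; rewrite (negPf (phi_off _ yc).1).
  - by rewrite phic => /eqP; rewrite (negPf (phi_off _ xc).1).
  - by rewrite /phi (negPf xc) (negPf yc); apply: h_inj; rewrite !inE.
have phi_bij : bijective phi by apply: inj_card_bij; rewrite ?nE.
have phiE x : phi @: [set c; x] = [set d; phi x] by rewrite imsetU1 imset_set1 phic.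
exists phi; split=> // e; last first.
  by rewrite TE => /imsetP[v /[!inE] vc ->]; rewrite phiE (phi_off _ vc).2.
rewrite SE TE; apply/imsetP/imsetP => [[v' /[!inE] vd eE]|[v /[!inE] vc ->]].
  have [psi _ psiK] := phi_bij; exists (psi v').
    by rewrite !inE; apply: contraNneq vd => pc; rewrite -phic -pc psiK.
  by apply: (imset_inj phi_inj); rewrite phiE psiK.
by exists (phi v); rewrite ?phiE // !inE (phi_off _ vc).1.
Qed.

(** The difference is (a - 1)(n - a - 1). *)
Lemma mul_subn_ge (n a : nat) : (0 < a)%N -> (a.*2 <= n)%N ->
  (n - 1 <= a * (n - a))%N /\ ((a * (n - a))%N = (n - 1)%N -> a = 1%N).
Proof.
move=> a0 an; have [b ->] : exists b, n = (b + a.*2)%N by exists (n - a.*2)%N; lia.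
case: a a0 {an} => // a _; rewrite -addnn; split; nia.
Qed.

Section Tree.
Variable G : wgraph R.
Hypothesis G_tree : is_tree G.

Lemma cut_sum_ge :
  (#|vert G| - 1)%:R * \sum_(e in edges G) (wt e)^-1 <= cut_sum G /\
  ((#|vert G| - 1)%:R * \sum_(e in edges G) (wt e)^-1 = cut_sum G ->
   forall e, e \in edges G -> cut_size e = 1%N).
Proof.
have cmp (e : {set vert G}) : e \in edges G ->
    (#|vert G| - 1)%:R * (wt e)^-1 <= (cut_size e * (#|vert G| - cut_size e))%:R / wt e.
  move=> eG; rewrite ler_pM2r ?invr_gt0 ?wt_gt0 // ler_nat.
  exact: (mul_subn_ge (cut_size_gt0 G_tree eG) (double_cut_size e)).1.
rewrite /cut_sum mulr_sumr; split=> [|sumE e eG]; first exact: ler_sum.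
apply: (mul_subn_ge (cut_size_gt0 G_tree eG) (double_cut_size e)).2.
have wt_neq0 : (wt e)^-1 != 0 by rewrite gt_eqF // invr_gt0 wt_gt0.
apply/eqP; rewrite -(eqr_nat R); apply/eqP/(mulIf wt_neq0)/eqP; rewrite -subr_eq0; apply/eqP.
have diff0 : \sum_(f in edges G) ((cut_size f * (#|vert G| - cut_size f))%:R / wt f
    - (#|vert G| - 1)%:R * (wt f)^-1) = 0 by rewrite sumrB sumE subrr.
apply: (psumr_eq0P _ diff0 eG) => f fG; rewrite subr_ge0; exact: cmp.
Qed.

Lemma cut_sum_star : is_star G ->
  cut_sum G = (#|vert G| - 1)%:R * \sum_(e in edges G) (wt e)^-1.
Proof.
move=> [c GE]; rewrite /cut_sum mulr_sumr; apply: eq_bigr => e eG.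
have c_adj y : y != c -> adj c y.
  by move=> yc; rewrite /adj GE; apply/imsetP; exists y; rewrite // !inE.
suff -> : cut_size e = 1%N by rewrite mul1n.
apply/eqP; rewrite eqn_leq cut_size_gt0 // andbT.
move: eG; rewrite GE => /imsetP[v]; rewrite !inE => vc ->.
rewrite cut_sizeE ?c_adj //; apply: leq_trans (geq_minr _ _) _.
rewrite -(cards1 v); apply/subset_leq_card/subsetP => y yv; rewrite inE.
apply: contraTT (yv) => y_v; have [->|yc] := eqVneq y c.
  by rewrite sideC ?c_adj // inE side_refl.
rewrite sideC ?c_adj // in_setC negbK.
rewrite -(@side_step _ _ _ c y) ?side_refl ?c_adj //.
apply: contra y_v => /eqP E; have : y \in [set c; v] by rewrite -E set22.
by rewrite !inE (negPf yc).
Qed.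

Lemma star_of_cut_size : (1 < #|vert G|)%N ->
  (forall e, e \in edges G -> cut_size e = 1%N) -> is_star G.
Proof.
move=> G_gt1 cut1.
have leaf (u w : vert G) : adj u w -> side [set u; w] u = [set u] \/ side [set u; w] w = [set w].
  move=> uw; have := cut1 _ uw; rewrite cut_sizeE // /minn; case: ifP => _ /eqP/cards1P[x E].
    by left; move: (side_refl [set u; w] u); rewrite E inE => /eqP->.
  by right; move: (side_refl [set u; w] w); rewrite E inE => /eqP->.
have [a [b [ab aE]]] : exists a b : vert G, adj a b /\ side [set a; b] a = [set a].
  have /card_gt0P[u _] := ltnW G_gt1.
  have [w uw] := has_neighbour G_tree G_gt1 u.
  by have [a [b [ab _ aE]]] := side_has_leaf G_tree uw; exists a, b.
have b_adj x : x != b -> adj b x.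
  move=> xb; have [w bw xw] := branch_exists G_tree xb.
  (* Either the branch of [w] is just [w], which is then [x], or [b] is also a leaf, with [a] as its
     only neighbour. *)
  have [bE|wE] := leaf _ _ bw; last by move: xw; rewrite wE inE => /eqP->.
  have ba : adj b a by rewrite adj_sym.
  have wa := leaf_neighbour bw bE ba.
  by move: xw; rewrite -wa setUC aE inE => /eqP->.
exists b; apply/esym/eqP; rewrite eqEcard; apply/andP; split.
  by apply/subsetP => _ /imsetP[x /[!inE] xb ->]; exact: b_adj.
rewrite card_edges // card_in_imset ?cardsC1 // => x y; rewrite !inE => xb yb /setP/(_ x).
by rewrite !inE eqxx orbT (negPf xb) => /esym/eqP.
Qed.

End Tree.

End Stars.

(** * Extremal trees with given weights *)

Section Existence.
Variables (R : realType) (W : {mset R}%mset).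
Hypothesis W_neq0 : W != mset0.
Hypothesis W_gt0 : forall x, x \in W -> 0 < x.
Implicit Types T S : wgraph R.

Lemma size_mset_gt0 : (0 < size W)%N.
Proof.
rewrite lt0n size_eq0; apply: contra W_neq0 => /eqP W0.
by apply/eqP/msetP => x; rewrite -(seq_mset_id W) W0 mset_seqE mset0E.
Qed.

Lemma TW_perm T : TW W T <-> is_tree T /\ perm_eq [seq wt e | e in edges T] W.
Proof.
rewrite /TW -{1}(seq_mset_id W); by split=> -[T_tree /eq_seq_msetP TW].
Qed.

Lemma TW_perm2 T S : TW W T -> TW W S ->
  perm_eq [seq wt e | e in edges T] [seq wt e | e in edges S].
Proof.
move=> /TW_perm[_ TW] /TW_perm[_]; rewrite perm_sym; exact: perm_trans.
Qed.

Lemma TW_gt1 T : TW W T -> (1 < #|vert T|)%N.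
Proof.
move=> /TW_perm[T_tree /perm_size]; rewrite size_map -cardE card_edges //.
by move=> E; have := size_mset_gt0; rewrite -E; case: #|_| => [|[|]].
Qed.

Lemma avg_hitting_time_le T S : TW W T -> TW W S ->
  (avg_hitting_time T <= avg_hitting_time S)%E = (cut_sum T <= cut_sum S).
Proof.
move=> TT SS; have TS := TW_perm2 TT SS.
have nE := card_vert_perm TT.1 SS.1 TS.
have volE : vol [set: vert T] = vol [set: vert S].
  rewrite !vol_setT; congr (_ * _).
  by rewrite -(sum_image (edges T) (@wt R T) id) -(sum_image (edges S) (@wt R S) id) (perm_big _ TS).
have vol_gt0 : 0 < vol [set: vert S].
  have /card_gt0P[x _] := SS.1.1.1.
  rewrite /vol (bigD1 x) ?inE //= ltr_wpDr ?(wdeg_gt0 SS.1 (TW_gt1 SS)) //.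
  by apply: sumr_ge0 => y _; exact/ltW/(wdeg_gt0 SS.1 (TW_gt1 SS)).
rewrite (avg_hitting_time_tree TT.1 (TW_gt1 TT)) (avg_hitting_time_tree SS.1 (TW_gt1 SS)).
rewrite lee_fin -!/(cut_sum _) nE volE ler_pM2l ?ler_pM2l //.
by rewrite invr_gt0 ltr0n expn_gt0 SS.1.1.1.
Qed.

Lemma star_exists : exists S, TW W S /\ is_star S.
Proof.
have W_pos x : x \in (W : seq R) -> 0 < x by exact: W_gt0.
pose S := parent_graph (fun i => leq0n i) (erefl (size W)) W_pos.
exists S; split; first by apply/TW_perm; split;
  [exact: parent_graph_tree | exact: perm_parent_graph].
exists (ord0 : 'I_(size W).+1).
have pe (i : 'I_(size W)) : parent_edge (fun=> 0%N) i = [set ord0; lift ord0 i].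
  by rewrite /parent_edge setUC; congr [set _; _]; apply: val_inj; rewrite /= inordK.
apply/setP => e; apply/imsetP/imsetP => [[i _ ->]|[v /[!inE] v0 ->]].
  by exists (lift ord0 i); rewrite ?pe // !inE.
by case: (unliftP ord0 v) v0 => [i ->|->]; [exists i; rewrite ?pe | rewrite eqxx].
Qed.

Lemma polarized_path_exists : exists P, TW W P /\ is_polarized_path P.
Proof.
pose n := (size W).+1; pose c := path_c n.
(* [L] lists the edge indices from the ends to the centre and [w] the weights in decreasing order;
   edge i receives the weight at the rank of i in [L]. *)
pose L := sort (fun i j => (c i <= c j)%N) (iota 1 (size W)).
pose w := sort >=%R W.
pose s := [seq nth 0 w (index i L) | i <- iota 1 (size W)].
have size_s : size s = size W by rewrite size_map size_iota.
have LE : perm_eq L (iota 1 (size W)) by rewrite perm_sort.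
have L_uniq : uniq L by rewrite (perm_uniq LE) iota_uniq.
have size_L : size L = size W by rewrite size_sort size_iota.
have sW : perm_eq s W.
  have wW : perm_eq w W by rewrite perm_sort.
  apply: perm_trans wW; apply: (@perm_trans _ [seq nth 0 w (index i L) | i <- L]).
    by apply: perm_map; rewrite perm_sym.
  rewrite (_ : map _ _ = w) //; apply: (@eq_from_nth _ 0).
    by rewrite size_map size_L size_sort.
  by move=> i; rewrite size_map => iL; rewrite (nth_map 0%N) // index_uniq.
have s_gt0 x : x \in s -> 0 < x by rewrite (perm_mem sW); exact: W_gt0.
pose P := parent_graph (fun i => leqnn i) size_s s_gt0.
have P_tree : is_tree P by exact: parent_graph_tree.
exists P; split.
  by apply/TW_perm; split=> //; apply: (perm_trans _ sW); exact: perm_parent_graph.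
(* Path labels start at 1, vertices at 0. *)
pose p i : 'I_n := inord i.-1.
have p_val i : (1 <= i <= n)%N -> p i = i.-1 :> nat by move=> iG; rewrite inordK; lia.
have pe (i : 'I_(size W)) : parent_edge id i = [set p i.+1; p i.+2].
  rewrite /parent_edge setUC; congr [set _; _]; apply: val_inj.
  by rewrite /= p_val //; have := ltn_ord i; rewrite /n ltnS.
have wtE i : (1 <= i < n)%N -> wt ([set p i; p i.+1] : {set vert P}) = nth 0 w (index i L).
  move=> iG; have i_lt : (i.-1 < size W)%N by rewrite /n in iG; lia.
  have := parent_wtE (fun i => leqnn i) size_s (Ordinal i_lt); rewrite pe /= prednK; last by lia.
  move=> ->; rewrite (nth_map 0%N) ?size_iota // nth_iota //; congr (nth _ _ (index _ _)); lia.
exists n, (p : nat -> vert P); split; first split.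
- move=> i j iG jG /(congr1 val) /=; rewrite !p_val //.
  by move: iG jG; rewrite !inE; lia.
- move=> x; exists x.+1; first by rewrite /= ltn_ord.
  by apply: val_inj; rewrite /= p_val //= ltn_ord.
- move=> e; split=> [/imsetP[i _ ->]|[i iG ->]].
    exists i.+1; [by have := ltn_ord i; rewrite /n; lia | exact: pe].
  have i_lt : (i.-1 < size W)%N by rewrite /n in iG; lia.
  by apply/imsetP; exists (Ordinal i_lt); rewrite // pe /= prednK //; lia.
move=> i j iG jG ij; rewrite !wtE //.
have mem_L k : (1 <= k < n)%N -> k \in L by move=> kG; rewrite (perm_mem LE) mem_iota.
have idx_lt k : (1 <= k < n)%N -> (index k L < size w)%N.
  by move=> kG; rewrite size_sort -size_L index_mem mem_L.
have w_sorted : sorted >=%R w by apply: sort_sorted => x y /=; exact: le_total.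
have L_sorted : sorted (fun i j => (c i <= c j)%N) L.
  by apply: sort_sorted => x y; exact: leq_total.
have ge_tr : transitive (>=%R : rel R) by move=> x y z /= h1 h2; exact: le_trans h2 h1.
have c_tr : transitive (fun i j => (c i <= c j)%N) by move=> x y z; exact: leq_trans.
have ge_refl : reflexive (>=%R : rel R) by move=> x /=.
apply: (sorted_leq_nth ge_tr ge_refl _ w_sorted); rewrite ?inE ?idx_lt //.
rewrite leqNgt; apply/negP => /ltnW ji; move: ij; rewrite ltnNge => /negP; apply.
by apply: (sorted_leq_index c_tr _ L_sorted) ji; rewrite ?mem_L.
Qed.

End Existence.

Theorem theorem2 (R : realType) (W : {mset R}%mset)
    (W_neq0 : W != mset0) (W_gt0 : forall x, x \in W -> 0 < x) :
  (forall T : wgraph R,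
     maximizes_alpha W T <-> TW W T /\ is_polarized_path T) /\
  exists S : wgraph R,
    [/\ TW W S /\ is_star S,
        forall T, TW W T -> is_star T -> wisom T S,
        minimizes_alpha W S &
        forall T, minimizes_alpha W T -> wisom T S].
Proof.
have le_avg := avg_hitting_time_le W_neq0.
split=> [T|].
  have path_max T' P : TW W T' -> TW W P -> is_polarized_path P ->
      cut_sum T' <= cut_sum P /\ (cut_sum T' = cut_sum P -> is_polarized_path T').
    by move=> T'W PW; apply: polarized_path_max T'W.1 PW.1 (TW_gt1 W_neq0 T'W) (TW_perm2 T'W PW).
  split=> [[TT T_max]|[TT T_pol]]; split=> //.
    (* A maximizer ties with an existing polarized path, so the equality case applies. *)
    have [P [PW P_pol]] := polarized_path_exists W_neq0 W_gt0.
    have [TP] := path_max _ _ TT PW P_pol; apply; apply/eqP; rewrite eq_le TP.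
    by rewrite -le_avg // T_max.
  by move=> T' T'W; rewrite le_avg //; exact: (path_max _ _ T'W TT T_pol).1.
have [S [SW S_star]] := star_exists W_gt0.
have S_wisom T : TW W T -> is_star T -> wisom T S.
  move=> TT T_star; have TS := TW_perm2 TT SW.
  exact: star_wisom (card_vert_perm TT.1 SW.1 TS) T_star S_star TS.
have S_sum T : TW W T ->
    cut_sum S = (#|vert T| - 1)%:R * \sum_(e in edges T) (wt e)^-1.
  move=> TT; have TS := TW_perm2 TT SW.
  rewrite (cut_sum_star SW.1 S_star) (card_vert_perm TT.1 SW.1 TS); congr (_ * _).
  by rewrite -(sum_image _ _ (@GRing.inv R)) -(perm_big _ TS) sum_image.
have S_min T : TW W T -> cut_sum S <= cut_sum T.
  by move=> TT; rewrite (S_sum T TT); exact: (cut_sum_ge TT.1).1.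
exists S; split=> //; first by split=> // T TT; rewrite le_avg //; exact: S_min.
move=> T [TT T_min]; apply: S_wisom => //.
apply: star_of_cut_size TT.1 (TW_gt1 W_neq0 TT) _.
apply: (cut_sum_ge TT.1).2; rewrite -S_sum //; apply/eqP.
by rewrite eq_le S_min // -le_avg // T_min.
Qed.
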